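(* Let $\Omega=\{1,2,3,4,5\}$. Up to isomorphism there are exactly two circulant association schemes on triples (ASTs) over $\Omega$ (of any order $m\geq 4$). The first is the AST whose sole nontrivial relation is $\Omega\times\Omega\times\Omega\setminus\bigcup_{i=0}^3R_i$, where $R_0,R_1,R_2,R_3$ are the trivial relations. The second has seven relations (order $6$), with nontrivial relations \begin{align*} R_4=\{&(1,2,3),(1,3,5),(1,4,2),(1,5,4),(2,1,5),(2,3,4),(2,4,1),(2,5,3),(3,1,4),(3,2,1),\\ &(3,4,5),(3,5,2),(4,1,3),(4,2,5),(4,3,2),(4,5,1),(5,1,2),(5,2,4),(5,3,1),(5,4,3)\},\\ R_5=\{&(1,2,4),(1,3,2),(1,4,5),(1,5,3),(2,1,4),(2,3,5),(2,4,3),(2,5,1),(3,1,2),(3,2,5),\\ &(3,4,1),(3,5,4),(4,1,5),(4,2,3),(4,3,1),(4,5,2),(5,1,3),(5,2,1),(5,3,4),(5,4,2)\},\\ R_6=\{&(1,2,5),(1,3,4),(1,4,3),(1,5,2),(2,1,3),(2,3,1),(2,4,5),(2,5,4),(3,1,5),(3,2,4),\\ &(3,4,2),(3,5,1),(4,1,2),(4,2,1),(4,3,5),(4,5,3),(5,1,4),(5,2,3),(5,3,2),(5,4,1)\}. \end{align*} Moreover, after identifying the underlying five-element sets by a bijection, the second AST is the AST induced by the two-transitive action of $AGL(1,5)$ on the Galois field $GF(5)$.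
   Context: Let $\Omega$ be a finite set with $|\Omega|=n\geq 3$. An association scheme on triples (AST) of order $m\geq 4$ on (or over) $\Omega$ is a partition $X=\{R_i\}_{i=0}^m$ of $\Omega\times\Omega\times\Omega$ (into $m+1$ nonempty parts) such that: (1) For each $i\in\{0,\ldots,m\}$ there is a constant $n_i^{(3)}\in\mathbb{N}\cup\{0\}$ such that $|\{z\in\Omega : (x,y,z)\in R_i\}|=n_i^{(3)}$ for any pair of distinct $x,y\in\Omega$. (2) For any $i,j,k,l\in\{0,\ldots,m\}$ there is a constant $p_{ijk}^l\in\mathbb{N}\cup\{0\}$ such that $|\{w\in\Omega : (w,y,z)\in R_i,\ (x,w,z)\in R_j,\ (x,y,w)\in R_k\}|=p_{ijk}^l$ for every $(x,y,z)\in R_l$. (3) For any $i\in\{0,\ldots,m\}$ and $\sigma\in S_3$ there is $j\in\{0,\ldots,m\}$ such that $R_i^\sigma:=\{(x_{\sigma(1)},x_{\sigma(2)},x_{\sigma(3)}) : (x_1,x_2,x_3)\in R_i\}=R_j$. (4) The first four relations are the trivial relations $R_0=\{(x,x,x):x\in\Omega\}$, $R_1=\{(y,x,x):x,y\in\Omega,\ x\neq y\}$, $R_2=\{(x,y,x):x,y\in\Omega,\ x\neq y\}$, $R_3=\{(x,x,y):x,y\in\Omega,\ x\neq y\}$. The relations $R_4,\ldots,R_m$ are called the nontrivial relations. An AST $\{R_i\}_{i=0}^m$ on $\Omega$ is circulant if there is a transitive cyclic subgroup $G\leq S_\Omega$ such that for every $i\in\{0,\ldots,m\}$, $\{(gx,gy,gz):g\in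 G,\ (x,y,z)\in R_i\}\subseteq R_i$. For $R\subseteq\Omega\times\Omega\times\Omega$ and $\sigma\in S_\Omega$, put $\sigma(R)=\{(\sigma(x),\sigma(y),\sigma(z)):(x,y,z)\in R\}$. Two ASTs $\{R_i\}_{i=0}^m$ and $\{S_i\}_{i=0}^m$ of order $m$ on $\Omega$ are isomorphic if there is $\sigma\in S_\Omega$ with $\{\sigma(R_i)\}_{i=0}^m=\{S_i\}_{i=0}^m$ as unordered sets. The AST induced by a two-transitive group $H$ acting on a set $\Omega$ with at least $4$ elements is the partition of $\Omega\times\Omega\times\Omega$ into the orbits of the natural (diagonal) action of $H$. Here $AGL(1,q)$ is the group of maps $x\mapsto ax+b$ of $GF(q)$ with $a\neq 0$. *)

(* Defs.v *)
From mathcomp Require Import all_boot all_order all_algebra all_fingroup all_solvable.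

Set Implicit Arguments.
Unset Strict Implicit.
Unset Printing Implicit Defensive.

Import GRing.Theory.

Section Triples.

Variable T : finType.

Definition triv0 : {set 3.-tuple T} := [set [tuple x; x; x] | x in T].
Definition triv1 : {set 3.-tuple T} :=
  [set [tuple y; x; x] | x in T, y in T & x != y].
Definition triv2 : {set 3.-tuple T} :=
  [set [tuple x; y; x] | x in T, y in T & x != y].
Definition triv3 : {set 3.-tuple T} :=
  [set [tuple x; x; y] | x in T, y in T & x != y].

Definition permute_coords (s : 'S_3) (R : {set 3.-tuple T}) : {set 3.-tuple T} :=
  [set [tuple tnth t (s a) | a < 3] | t in R].

Definition relset (m : nat) (R : 'I_m.+1 -> {set 3.-tuple T}) :
    {set {set 3.-tuple T}} :=
  [set R i | i : 'I_m.+1].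

(* The carrier has at least 3 points and the order m is at least 4; the latter
   makes the indices [inord 0], ..., [inord 3] the actual indices 0, ..., 3. *)
Record is_AST (m : nat) (R : 'I_m.+1 -> {set 3.-tuple T}) : Prop := IsAST {
  AST_card : 3 <= #|T|;
  AST_order : 4 <= m;
  AST_inj : injective R;
  AST_partition : partition (relset R) [set: 3.-tuple T];
  AST_valency : forall i, exists n3 : nat, forall x y, x != y ->
    #|[set z | [tuple x; y; z] \in R i]| = n3;
  AST_intersection : forall i j k l, exists p : nat, forall x y z,
    [tuple x; y; z] \in R l ->
    #|[set w | [&& [tuple w; y; z] \in R i, [tuple x; w; z] \in R j
                 & [tuple x; y; w] \in R k]]| = p;
  AST_sym : forall i (s : 'S_3), exists j, permute_coords s (R i) = R j;
  AST_triv0 : R (inord 0) = triv0;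
  AST_triv1 : R (inord 1) = triv1;
  AST_triv2 : R (inord 2) = triv2;
  AST_triv3 : R (inord 3) = triv3
}.

Definition circulant (m : nat) (R : 'I_m.+1 -> {set 3.-tuple T}) : Prop :=
  exists G : {group {perm T}},
    [/\ [transitive G, on [set: T] | 'P], cyclic G
      & forall i, [set map_tuple (g : {perm T}) t | g in G, t in R i] \subset R i].

End Triples.

Definition relabel (T U : finType) (f : T -> U) (R : {set 3.-tuple T}) :
    {set 3.-tuple U} :=
  [set map_tuple f t | t in R].

Definition isomorphic (T : finType) (m m' : nat)
    (R : 'I_m.+1 -> {set 3.-tuple T}) (S : 'I_m'.+1 -> {set 3.-tuple T}) : Prop :=
  m = m' /\
  exists s : {perm T}, [set relabel s (R i) | i : 'I_m.+1] = relset S.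

(* [to * 3] is the diagonal action on triples. *)
Definition induced_by (aT : finGroupType) (T : finType) (H : {group aT})
    (to : {action aT &-> T}) (m : nat) (R : 'I_m.+1 -> {set 3.-tuple T}) : Prop :=
  [/\ 4 <= #|T|, [transitive^2 H, on [set: T] | to]
    & relset R = [set orbit (to * 3)%act H t | t : 3.-tuple T]].

Section AffineGroup.

Variable F : finFieldType.
Local Open Scope ring_scope.

Definition AGL1 : {set {perm F}} :=
  [set s : {perm F} | [exists a : F, exists b : F,
     (a != 0) && [forall x, s x == a * x + b]]].

Lemma AGL1P (s : {perm F}) :
  reflect (exists a b : F, a != 0 /\ forall x, s x = a * x + b) (s \in AGL1).
Proof.
rewrite inE; apply: (iffP existsP) => [[a /existsP[b /andP[a0 /forallP h]]]|].
  by exists a, b; split=> // x; apply/eqP.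
case=> a [b [a0 h]]; exists a; apply/existsP; exists b; rewrite a0 /=.
by apply/forallP=> x; apply/eqP.
Qed.

Fact AGL1_group_set : group_set AGL1.
Proof.
apply/group_setP; split.
  apply/AGL1P; exists 1, 0; split=> [|x]; first exact: oner_neq0.
  by rewrite perm1 mul1r addr0.
move=> s t /AGL1P[a [b [a0 sE]]] /AGL1P[c [d [c0 tE]]]; apply/AGL1P.
exists (c * a), (c * b + d); split=> [|x]; first by rewrite mulf_neq0.
by rewrite permM sE tE mulrDr mulrA addrA.
Qed.

Canonical AGL1_group := Group AGL1_group_set.

End AffineGroup.

(* The points 1, ..., 5 are the elements of ['I_5], the point labelled k being
   the ordinal of value k - 1. *)
Definition triples5 (s : seq (seq nat)) : {set 3.-tuple 'I_5} :=
  [set t : 3.-tuple 'I_5 | [seq (val i).+1 | i <- t] \in s].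

Definition R4 : {set 3.-tuple 'I_5} := triples5
  [:: [:: 1;2;3]; [:: 1;3;5]; [:: 1;4;2]; [:: 1;5;4]; [:: 2;1;5];
      [:: 2;3;4]; [:: 2;4;1]; [:: 2;5;3]; [:: 3;1;4]; [:: 3;2;1];
      [:: 3;4;5]; [:: 3;5;2]; [:: 4;1;3]; [:: 4;2;5]; [:: 4;3;2];
      [:: 4;5;1]; [:: 5;1;2]; [:: 5;2;4]; [:: 5;3;1]; [:: 5;4;3]].

Definition R5 : {set 3.-tuple 'I_5} := triples5
  [:: [:: 1;2;4]; [:: 1;3;2]; [:: 1;4;5]; [:: 1;5;3]; [:: 2;1;4];
      [:: 2;3;5]; [:: 2;4;3]; [:: 2;5;1]; [:: 3;1;2]; [:: 3;2;5];
      [:: 3;4;1]; [:: 3;5;4]; [:: 4;1;5]; [:: 4;2;3]; [:: 4;3;1];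
      [:: 4;5;2]; [:: 5;1;3]; [:: 5;2;1]; [:: 5;3;4]; [:: 5;4;2]].

Definition R6 : {set 3.-tuple 'I_5} := triples5
  [:: [:: 1;2;5]; [:: 1;3;4]; [:: 1;4;3]; [:: 1;5;2]; [:: 2;1;3];
      [:: 2;3;1]; [:: 2;4;5]; [:: 2;5;4]; [:: 3;1;5]; [:: 3;2;4];
      [:: 3;4;2]; [:: 3;5;1]; [:: 4;1;2]; [:: 4;2;1]; [:: 4;3;5];
      [:: 4;5;3]; [:: 5;1;4]; [:: 5;2;3]; [:: 5;3;2]; [:: 5;4;1]].

Definition trivials (T : finType) : seq {set 3.-tuple T} :=
  [:: triv0 T; triv1 T; triv2 T; triv3 T].

Definition AST5_first (i : 'I_4.+1) : {set 3.-tuple 'I_5} :=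
  nth set0 (rcons (trivials 'I_5)
    ([set: 3.-tuple 'I_5] :\:
       (triv0 'I_5 :|: triv1 'I_5 :|: triv2 'I_5 :|: triv3 'I_5))) i.

Definition AST5_second (i : 'I_6.+1) : {set 3.-tuple 'I_5} :=
  nth set0 (trivials 'I_5 ++ [:: R4; R5; R6]) i.

(* Main.v *)
Require Import Defs.
From mathcomp Require Import all_boot all_order all_algebra all_fingroup all_solvable.

Set Implicit Arguments.
Unset Strict Implicit.
Unset Printing Implicit Defensive.

Import GRing.Theory.

(** Existence.  The orbits on triples of a two-transitive group form an AST
    ([orbit_scheme_AST]), and it is circulant when the group contains a transitive
    cyclic subgroup ([circulant_of_orbits]).  The first scheme comes from the
    symmetric group, the second from the affine group of [GF(5)]: the affine orbits
    on triples of distinct points are the sets where the ratio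
    [(z - x) / (y - x)] is 2, 3 or 4, and these are [R4], [R5] and [R6].  The
    numerals 0, ..., 4 of ['I_5] are the elements of ['F_5], so the identity map is
    the required identification of the point sets.

    Uniqueness.  In any AST on five points the valencies of the nontrivial
    relations add up to 3.  Exchanging the last two coordinates permutes these
    relations and preserves valencies, and since 3 is odd some fixed relation has
    odd valency ([odd_swap23_stable]), which is 3 or 1.  Valency 3 means that this
    relation contains all triples of distinct points, which gives the first scheme
    ([valency_three]).  If the valency is 1, number the points along a 5-cycle
    preserving the scheme; the triples of the relation with first point 0 define a
    perfect matching of 1, 2, 3, 4.  Every pair of distinct points occurs as the
    last two coordinates of some triple of the relation, so every nonzero
    difference modulo 5 occurs in the matching, and the only such matching pairs
    1 with 4 and 2 with 3 ([unique_matching]).  The relation is then [R6]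
    ([valency_one]).  The sets [R4] and [R5] are coordinate permutations of [R6],
    hence relations as well, and together with the trivial relations they
    exhaust the triples ([isomorphic_by_coordinates]). *)

(** * Triples and permutations of their coordinates *)

Section Triples.
Variable T : finType.
Implicit Types (x y z : T) (t : 3.-tuple T) (R : {set 3.-tuple T}).

Lemma tuple3P t : exists x y z, t = [tuple x; y; z].
Proof.
by case: t => [[|x [|y [|z []]]] // szt]; exists x, y, z; apply: val_inj.
Qed.

Lemma eq_tuple3 x y z x' y' z' :
  ([tuple x; y; z] == [tuple x'; y'; z']) = [&& x == x', y == y' & z == z'].
Proof. by rewrite -val_eqE /= !eqseq_cons andbT. Qed.

Lemma in_triv0 x y z : ([tuple x; y; z] \in triv0 T) = (x == y) && (y == z).
Proof.
apply/imsetP/andP => [[a _ /eqP]|[/eqP-> /eqP->]]; last by exists z.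
by rewrite eq_tuple3 => /and3P[/eqP-> /eqP-> /eqP->].
Qed.

Lemma in_triv1 x y z : ([tuple x; y; z] \in triv1 T) = (x != y) && (y == z).
Proof.
apply/imset2P/andP => [[a b _]|[xy /eqP yz]].
  rewrite inE andTb => ab /eqP; rewrite eq_tuple3.
  by case/and3P => /eqP-> /eqP-> /eqP->; rewrite eq_sym ab.
by exists z x; rewrite ?inE ?yz //= eq_sym -yz.
Qed.

Lemma in_triv2 x y z : ([tuple x; y; z] \in triv2 T) = (x != y) && (x == z).
Proof.
apply/imset2P/andP => [[a b _]|[xy /eqP xz]].
  rewrite inE andTb => ab /eqP; rewrite eq_tuple3.
  by case/and3P => /eqP-> /eqP-> /eqP->; rewrite ab.
by exists x y; rewrite ?inE // xz.
Qed.

Lemma in_triv3 x y z : ([tuple x; y; z] \in triv3 T) = (x == y) && (y != z).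
Proof.
apply/imset2P/andP => [[a b _]|[/eqP-> yz]].
  rewrite inE andTb => ab /eqP; rewrite eq_tuple3.
  by case/and3P => /eqP-> /eqP-> /eqP->; rewrite ab.
by exists y z; rewrite ?inE.
Qed.

Lemma in_permute_coords (s : 'S_3) R t :
  (t \in permute_coords s R) = ([tuple tnth t ((s^-1)%g a) | a < 3] \in R).
Proof.
apply/imsetP/idP => [[u uR ->]|tR].
  suff -> : [tuple tnth [tuple tnth u (s b) | b < 3] ((s^-1)%g a) | a < 3] = u.
    by [].
  by apply: eq_from_tnth => a; rewrite !tnth_mktuple permKV.
by exists [tuple tnth t ((s^-1)%g a) | a < 3] => //; apply: eq_from_tnth => a;
  rewrite !tnth_mktuple permK.
Qed.

Definition swap12 : 'S_3 := tperm (inord 0) (inord 1).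
Definition swap13 : 'S_3 := tperm (inord 0) (inord 2).
Definition swap23 : 'S_3 := tperm (inord 1) (inord 2).

Lemma mktuple3 (F : 'I_3 -> T) :
  [tuple F a | a < 3] = [tuple F (inord 0); F (inord 1); F (inord 2)].
Proof.
apply: eq_from_tnth => a; rewrite tnth_mktuple (tnth_nth (F a)) /=.
by case: a => [[|[|[|//]]] ?] /=; congr F; apply: val_inj; rewrite /= inordK.
Qed.

Lemma in_swap12 x y z R :
  ([tuple x; y; z] \in permute_coords swap12 R) = ([tuple y; x; z] \in R).
Proof.
rewrite in_permute_coords mktuple3 tpermV tpermL tpermR tpermD.
  by rewrite !(tnth_nth x) /= !inordK.
all: by rewrite -val_eqE /= !inordK.
Qed.

Lemma in_swap13 x y z R :
  ([tuple x; y; z] \in permute_coords swap13 R) = ([tuple z; y; x] \in R).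
Proof.
rewrite in_permute_coords mktuple3 tpermV tpermL tpermR tpermD.
  by rewrite !(tnth_nth x) /= !inordK.
all: by rewrite -val_eqE /= !inordK.
Qed.

Lemma in_swap23 x y z R :
  ([tuple x; y; z] \in permute_coords swap23 R) = ([tuple x; z; y] \in R).
Proof.
rewrite in_permute_coords mktuple3 tpermV tpermL tpermR tpermD.
  by rewrite !(tnth_nth x) /= !inordK.
all: by rewrite -val_eqE /= !inordK.
Qed.

End Triples.

(** * Association schemes on triples *)

Section Schemes.
Variables (T : finType) (m : nat) (R : 'I_m.+1 -> {set 3.-tuple T}).
Hypothesis A : is_AST R.
Implicit Types (x y z : T) (i j : 'I_m.+1).

Lemma AST_mem t : exists i, t \in R i.
Proof.
have /and3P[/eqP cov _ _] := AST_partition A.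
have : t \in cover (relset R) by rewrite cov.
by case/bigcupP => _ /imsetP[i _ ->]; exists i.
Qed.

Lemma AST_uniq t i j : t \in R i -> t \in R j -> i = j.
Proof.
move=> tRi tRj; have /and3P[_ tI _] := AST_partition A.
apply: (AST_inj A); rewrite -(def_pblock tI _ tRi) ?imset_f //.
by rewrite (def_pblock tI _ tRj) ?imset_f.
Qed.

Lemma AST_nonempty i : exists t, t \in R i.
Proof.
have /and3P[_ _ n0] := AST_partition A.
apply/set0Pn; apply: contraNneq n0 => <-; exact: imset_f.
Qed.

(** Every triple with a repeated coordinate lies in a trivial relation, so being
    nontrivial can be read off from any one triple of the relation. *)
Lemma AST_nontrivial i x y z :
  [tuple x; y; z] \in R i -> (4 <= i) = [&& x != y, x != z & y != z].
Proof.
move=> tRi; have m4 := AST_order A.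
have idx k : k < 4 -> [tuple x; y; z] \in R (inord k) -> (4 <= i) = false.
  move=> k4 /(AST_uniq tRi) ->.
  by rewrite inordK ?(leq_trans k4 (leqW m4)) // leqNgt k4.
have [xy|xy] := eqVneq x y.
  have [yz|yz] := eqVneq y z.
    by rewrite (idx 0) // (AST_triv0 A) in_triv0 xy yz !eqxx.
  by rewrite (idx 3) // (AST_triv3 A) in_triv3 xy yz eqxx.
have [xz|xz] := eqVneq x z.
  by rewrite (idx 2) // (AST_triv2 A) in_triv2 xy xz eqxx.
have [yz|yz] := eqVneq y z.
  by rewrite (idx 1) // (AST_triv1 A) in_triv1 xy yz eqxx.
apply/negbNE/negP; rewrite -ltnNge => i4.
move: tRi; rewrite -(inord_val i).
case: (val i) i4 => [|[|[|[|//]]]] _.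
- by rewrite (AST_triv0 A) in_triv0 (negbTE xy).
- by rewrite (AST_triv1 A) in_triv1 (negbTE yz) andbF.
- by rewrite (AST_triv2 A) in_triv2 (negbTE xz) andbF.
by rewrite (AST_triv3 A) in_triv3 (negbTE xy).
Qed.

Lemma AST_fiber_sub i x y : 4 <= i -> x != y ->
  [set z | [tuple x; y; z] \in R i] \subset ~: [set x; y].
Proof.
move=> i4 xy; apply/subsetP => z; rewrite !inE => /AST_nontrivial.
by rewrite i4 xy negb_or ![z == _]eq_sym => /esym.
Qed.

Lemma AST_permute (s : 'S_3) :
  exists f : 'I_m.+1 -> 'I_m.+1, forall i, permute_coords s (R i) = R (f i).
Proof. exact: (fin_all_exists (fun i => AST_sym A i s)). Qed.

(** A nontrivial relation has positive valency: it is nonempty, and the valency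
    can be computed at the pair of points given by any of its triples. *)
Lemma AST_extend i x y : 4 <= i -> x != y -> exists z, [tuple x; y; z] \in R i.
Proof.
move=> i4 xy; have [t] := AST_nonempty i; have [a [b [c ->]]] := tuple3P t.
move=> abc; have := AST_nontrivial abc; rewrite i4 => /esym/and3P[ab _ _].
have [n valn] := AST_valency A i.
have : 0 < #|[set z | [tuple x; y; z] \in R i]|.
  by rewrite (valn _ _ xy) -(valn _ _ ab); apply/card_gt0P; exists c; rewrite inE.
by case/card_gt0P => z; rewrite inE; exists z.
Qed.

Lemma AST_permute_nontrivial (s : 'S_3) i j :
  permute_coords s (R i) = R j -> 4 <= i -> 4 <= j.
Proof.
move=> sij i4; have [t ti] := AST_nonempty i.
have [a [b [c dt]]] := tuple3P t; rewrite dt in ti.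
have /esym := AST_nontrivial ti; rewrite i4 => abc.
have ut : uniq t by rewrite dt /= !inE negb_or andbT -andbA.
rewrite -dt in ti.
have : [tuple tnth t (s a) | a < 3] \in R j by rewrite -sij; apply: imset_f.
have us : uniq [tuple tnth t (s a) | a < 3].
  apply/tuple_uniqP => k l; rewrite !tnth_mktuple => e.
  by apply: (@perm_inj _ s); apply: (tuple_uniqP _ ut) e.
have [a' [b' [c' dt']]] := tuple3P [tuple tnth t (s a) | a < 3].
rewrite dt' in us *; move/AST_nontrivial => ->.
by move: us; rewrite /= !inE negb_or andbT -andbA.
Qed.

End Schemes.

Section Isomorphism.
Variables (T : finType) (m p : nat).
Variables (R : 'I_m.+1 -> {set 3.-tuple T}) (S : 'I_p.+1 -> {set 3.-tuple T}).

(** Both schemes partition the same set of triples: once every relation of [S] is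
    a relation of [R] read in the coordinates [s], no relation of [R] is left over,
    and injectivity of the numberings gives equality of the orders. *)
Lemma isomorphic_by_coordinates (s : {perm T}) :
  is_AST R -> is_AST S ->
  (forall j, exists i, forall x y z,
     ([tuple s x; s y; s z] \in R i) = ([tuple x; y; z] \in S j)) ->
  isomorphic R S.
Proof.
move=> AR AS coordS; pose r := (s^-1)%g.
have rK (t : 3.-tuple T) : map_tuple s (map_tuple r t) = t.
  by apply: eq_from_tnth => k; rewrite !tnth_map /r permKV.
have Kr (t : 3.-tuple T) : map_tuple r (map_tuple s t) = t.
  by apply: eq_from_tnth => k; rewrite !tnth_map /r permK.
have r_inj : injective (map_tuple r : 3.-tuple T -> 3.-tuple T) := can_inj rK.
have rS j : exists i, relabel r (R i) = S j.
  have [i RiS] := coordS j; exists i; apply/setP => t.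
  rewrite -{1}(Kr t) (mem_imset _ _ r_inj).
  have [x [y [z ->]]] := tuple3P t; rewrite -RiS; congr (_ \in R i).
  exact: val_inj.
have eqRS : [set relabel r (R i) | i : 'I_m.+1] = relset S.
  apply/setP => D; apply/imsetP/imsetP => [[i _ ->]|[j _ ->]]; last first.
    by have [i Rij] := rS j; exists i.
  have [t tRi] := AST_nonempty AR i.
  have [j tSj] := AST_mem AS (map_tuple r t); exists j => //.
  have [k Rkj] := rS j; rewrite -Rkj; congr (relabel r (R _)).
  by apply: AST_uniq tRi _ => //; rewrite -Rkj (mem_imset _ _ r_inj) in tSj.
split; last by exists r.
have relabel_inj : injective (fun i => relabel r (R i)).
  by move=> i j /(imset_inj r_inj)/(AST_inj AR).
have cardR : #|[set relabel r (R i) | i : 'I_m.+1]| = m.+1.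
  by rewrite card_imset // card_ord.
have cardS : #|relset S| = p.+1 by rewrite (card_imset _ (AST_inj AS)) card_ord.
by apply: succn_inj; rewrite -cardR eqRS.
Qed.

End Isomorphism.

(** * Schemes induced by two-transitive groups *)

Section OrbitSchemes.
Variables (aT : finGroupType) (T : finType) (H : {group aT}).
Variable to : {action aT &-> T}.
Hypothesis tr2 : [transitive^2 H, on [set: T] | to].
Implicit Types (x y z : T) (t : 3.-tuple T).

Lemma act_tuple3 x y z h :
  (to * 3)%act [tuple x; y; z] h = [tuple to x h; to y h; to z h].
Proof. exact: val_inj. Qed.

Lemma two_transitiveP x y x' y' :
  x != y -> x' != y' -> exists2 h, h \in H & to x h = x' /\ to y h = y'.
Proof.
move=> xy xy'.
have dt a b : a != b -> [tuple a; b] \in 2.-dtuple([set: T]).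
  by move=> ab; rewrite inE /= inE ab; apply/subsetP => c _; rewrite inE.
have [h hH [-> ->]] := atransP2 tr2 (dt _ _ xy) (dt _ _ xy').
by exists h.
Qed.

Lemma triv0_orbit x : triv0 T = orbit (to * 3)%act H [tuple x; x; x].
Proof.
apply/setP => t; have [a [b [c ->]]] := tuple3P t; rewrite in_triv0.
apply/andP/imsetP => [[/eqP-> /eqP->]|[h hH]].
  have [h hH ->] := atransP2 (ntransitive1 (isT : 0 < 2) tr2) (in_setT x) (in_setT c).
  by exists h; rewrite // act_tuple3.
by rewrite act_tuple3 => /eqP; rewrite eq_tuple3 => /and3P[/eqP-> /eqP-> /eqP->].
Qed.

Lemma triv1_orbit x y : x != y -> triv1 T = orbit (to * 3)%act H [tuple x; y; y].
Proof.
move=> xy; apply/setP => t; have [a [b [c ->]]] := tuple3P t; rewrite in_triv1.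
apply/andP/imsetP => [[ab /eqP<-]|[h hH]].
  by have [h hH [<- <-]] := two_transitiveP xy ab; exists h; rewrite // act_tuple3.
rewrite act_tuple3 => /eqP; rewrite eq_tuple3 => /and3P[/eqP-> /eqP-> /eqP->].
by rewrite (inj_eq (act_inj _ _)).
Qed.

Lemma triv2_orbit x y : x != y -> triv2 T = orbit (to * 3)%act H [tuple x; y; x].
Proof.
move=> xy; apply/setP => t; have [a [b [c ->]]] := tuple3P t; rewrite in_triv2.
apply/andP/imsetP => [[ab /eqP<-]|[h hH]].
  by have [h hH [<- <-]] := two_transitiveP xy ab; exists h; rewrite // act_tuple3.
rewrite act_tuple3 => /eqP; rewrite eq_tuple3 => /and3P[/eqP-> /eqP-> /eqP->].
by rewrite (inj_eq (act_inj _ _)).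
Qed.

Lemma triv3_orbit x y : x != y -> triv3 T = orbit (to * 3)%act H [tuple x; x; y].
Proof.
move=> xy; apply/setP => t; have [a [b [c ->]]] := tuple3P t; rewrite in_triv3.
apply/andP/imsetP => [[/eqP<- ab]|[h hH]].
  by have [h hH [<- <-]] := two_transitiveP xy ab; exists h; rewrite // act_tuple3.
rewrite act_tuple3 => /eqP; rewrite eq_tuple3 => /and3P[/eqP-> /eqP-> /eqP->].
by rewrite eqxx (inj_eq (act_inj _ _)).
Qed.

Lemma permute_coords_orbit (s : 'S_3) t :
  permute_coords s (orbit (to * 3)%act H t)
  = orbit (to * 3)%act H [tuple tnth t (s a) | a < 3].
Proof.
rewrite /permute_coords /orbit -imset_comp; apply: eq_imset => h /=.
by apply: eq_from_tnth => a; rewrite !(tnth_mktuple, tnth_map).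
Qed.

(** A two-transitive group has exactly four orbits on the triples with a
    repeated coordinate, the trivial relations.  A scheme is therefore induced by
    [H] as soon as its nontrivial relations [L] are orbits covering the triples of
    distinct points; the numbering puts the trivial relations first, as in
    the concrete schemes on five points. *)
Variable L : seq {set 3.-tuple T}.
Hypothesis T4 : 4 <= #|T|.
Hypothesis L_neq0 : L != [::].
Hypothesis uniqL : uniq L.
Hypothesis orbitL : forall D, D \in L ->
  exists x y z, uniq [:: x; y; z] /\ D = orbit (to * 3)%act H [tuple x; y; z].
Hypothesis coverL : forall x y z, uniq [:: x; y; z] ->
  exists2 D, D \in L & [tuple x; y; z] \in D.

Let R (i : 'I_(size L + 3).+1) := nth set0 (trivials T ++ L) i.

Let two_points : exists x y : T, x != y.
Proof. by have /card_gt1P[x [y [_ _ xy]]] := leq_trans (isT : 1 < 4) T4; exists x, y. Qed.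

Let size_trivials : size (trivials T ++ L) = (size L + 3).+1.
Proof. by rewrite size_cat addnC -addnS. Qed.

Let R_mem i : R i \in trivials T ++ L.
Proof. by rewrite mem_nth // size_trivials. Qed.

Let mem_R D : D \in trivials T ++ L -> exists i, R i = D.
Proof.
rewrite -index_mem => lt_D; have lt_D' := lt_D; rewrite size_trivials in lt_D'.
by exists (Ordinal lt_D'); rewrite /R nth_index // -index_mem.
Qed.

Let R_orbit i : exists t, R i = orbit (to * 3)%act H t.
Proof.
have [x [y xy]] := two_points.
have := R_mem i; rewrite mem_cat => /orP[|/orbitL[a [b [c [_ ->]]]]]; last first.
  by exists [tuple a; b; c].
rewrite !inE => /or4P[]/eqP->.
- by exists [tuple x; x; x]; apply: triv0_orbit.
- by exists [tuple x; y; y]; apply: triv1_orbit.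
- by exists [tuple x; y; x]; apply: triv2_orbit.
by exists [tuple x; x; y]; apply: triv3_orbit.
Qed.

Let R_cover t : exists i, t \in R i.
Proof.
have [x [y [z ->]]] := tuple3P t.
suff [D /mem_R[i <-]] : exists2 D, D \in trivials T ++ L & [tuple x; y; z] \in D.
  by exists i.
have [u|] := boolP (uniq [:: x; y; z]).
  by have [D DL tD] := coverL u; exists D => //; rewrite mem_cat DL orbT.
rewrite /= !inE andbT negb_and negb_or !negbK => degen.
have [xy|xy] := eqVneq x y; first have [yz|yz] := eqVneq y z.
- by exists (triv0 T); rewrite ?inE ?eqxx // in_triv0 xy yz !eqxx.
- by exists (triv3 T); rewrite ?inE ?eqxx ?orbT // in_triv3 xy yz eqxx.
have [xz|xz] := eqVneq x z.
  by exists (triv2 T); rewrite ?inE ?eqxx ?orbT // in_triv2 xy xz eqxx.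
exists (triv1 T); rewrite ?inE ?eqxx ?orbT // in_triv1 xy.
by move: degen; rewrite (negbTE xy) (negbTE xz).
Qed.

Let R_orbits : relset R = [set orbit (to * 3)%act H t | t : 3.-tuple T].
Proof.
apply/setP => D; apply/imsetP/imsetP => [[i _ ->]|[t _ ->]].
  by have [t Rt] := R_orbit i; exists t.
have [i] := R_cover t; have [u Ru] := R_orbit i.
by rewrite Ru => /orbit_eqP tu; exists i; rewrite // Ru tu.
Qed.

Let R_inj : injective R.
Proof.
suff u : uniq (trivials T ++ L).
  by move=> i j /eqP; rewrite nth_uniq ?size_trivials // => /eqP/val_inj.
have [x [y xy]] := two_points; have yx : y != x by rewrite eq_sym.
have neq (D E : {set 3.-tuple T}) t : t \in D -> t \notin E -> D != E.
  by move=> tD; apply: contraNneq => <-.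
rewrite cat_uniq uniqL andbT; apply/andP; split.
  rewrite /= !inE !negb_or /= andbT -!andbA; do 5?[apply/andP; split].
  - by apply: (neq _ _ [tuple x; x; x]); rewrite (in_triv0, in_triv1) ?eqxx.
  - by apply: (neq _ _ [tuple x; x; x]); rewrite (in_triv0, in_triv2) ?eqxx.
  - by apply: (neq _ _ [tuple x; x; x]); rewrite (in_triv0, in_triv3) ?eqxx.
  - by apply: (neq _ _ [tuple x; y; y]); rewrite (in_triv1, in_triv2) ?(negbTE xy, eqxx).
  - by apply: (neq _ _ [tuple x; y; y]); rewrite (in_triv1, in_triv3) ?(negbTE xy, eqxx).
  by apply: (neq _ _ [tuple x; y; x]); rewrite (in_triv2, in_triv3) ?(negbTE xy, eqxx).
apply/hasPn => D /orbitL[a [b [c [abc ->]]]].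
move: abc; rewrite /= !inE negb_or andbT -andbA => /and3P[ab ac bc].
have tD := orbit_refl (to * 3)%act H [tuple a; b; c].
by rewrite !negb_or; apply/and4P; split; apply: (neq _ _ _ tD);
  rewrite (in_triv0, in_triv1, in_triv2, in_triv3) ?(negbTE ab, negbTE ac, negbTE bc).
Qed.

Lemma orbit_scheme_induced : induced_by H to R.
Proof. by split. Qed.

(** The counts in the valency and intersection conditions are transported by the
    group elements: two-transitivity moves one pair of distinct points to any
    other, and two triples of one relation are exchanged by construction. *)
Lemma orbit_scheme_AST : is_AST R.
Proof.
have stable i x y z h : h \in H ->
    ([tuple to x h; to y h; to z h] \in R i) = ([tuple x; y; z] \in R i).
  move=> hH; have [t ->] := R_orbit i.
  by rewrite -act_tuple3 orbit_actr.
split.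
- exact: ltnW.
- by case: (L) L_neq0 => //= D L' _; rewrite addSn addnC.
- exact: R_inj.
- rewrite R_orbits (_ : [set _ | t : _] =
    [set orbit (to * 3)%act H t | t in [set: 3.-tuple T]]).
    by apply/orbit_partition/actsP => h _ t; rewrite !inE.
  by apply/setP => D; apply/imsetP/imsetP => -[t _ ->]; exists t.
- move=> i; have [x [y xy]] := two_points.
  exists #|[set z | [tuple x; y; z] \in R i]| => x' y' xy'.
  have [h hH [<- <-]] := two_transitiveP xy xy'.
  rewrite -[RHS](card_imset _ (act_inj to h)); congr #|pred_of_set _|.
  apply/setP => z; rewrite -(actKV to h z) (mem_imset _ _ (act_inj _ _)) !inE.
  exact: stable.
- move=> i j k l; have [t Rl] := R_orbit l.
  have [x [y [z dt]]] := tuple3P t; rewrite dt in Rl.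
  exists #|[set w | [&& [tuple w; y; z] \in R i, [tuple x; w; z] \in R j
                 & [tuple x; y; w] \in R k]]| => x' y' z'.
  rewrite Rl => /imsetP[h hH]; rewrite act_tuple3 => /eqP.
  rewrite eq_tuple3 => /and3P[/eqP-> /eqP-> /eqP->].
  rewrite -[RHS](card_imset _ (act_inj to h)); congr #|pred_of_set _|.
  apply/setP => w; rewrite -(actKV to h w) (mem_imset _ _ (act_inj _ _)) !inE.
  by rewrite !stable.
- move=> i s; have [t ->] := R_orbit i; rewrite permute_coords_orbit.
  have [j] := R_cover [tuple tnth t (s a) | a < 3]; have [u Ru] := R_orbit j.
  by rewrite Ru => /orbit_eqP e; exists j; rewrite Ru e.
- by rewrite /R inordK // addnC.
- by rewrite /R inordK // addnC.
- by rewrite /R inordK // addnC.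
by rewrite /R inordK // addnC.
Qed.

End OrbitSchemes.

Lemma circulant_of_orbits (T : finType) (H : {group {perm T}}) (g : {perm T})
    m (R : 'I_m.+1 -> {set 3.-tuple T}) :
  induced_by H 'P R -> g \in H -> [transitive <[g]>%g, on [set: T] | 'P] ->
  circulant R.
Proof.
case=> _ _ orbR gH trg; exists <[g]>%G; split=> //; first exact: cycle_cyclic.
move=> i; apply/subsetP => _ /imset2P[h t gh tRi ->].
have : R i \in relset R by apply: imset_f.
rewrite orbR => /imsetP[u _ Ru]; rewrite Ru in tRi *.
have hH : h \in H by apply: subsetP gh; rewrite cycle_subG.
have <- : ('P * 3)%act t h = map_tuple h t by apply: val_inj.
by rewrite orbit_actr.
Qed.

(** * The affine group of a finite field *)

Section Affine.
Variable F : finFieldType.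
Local Open Scope ring_scope.
Implicit Types x y z a b : F.

Definition affine_fun a b x := a * x + b.

Lemma affine_fun_inj a b : a != 0 -> injective (affine_fun a b).
Proof. by move=> a0 x y /addIr/(mulfI a0). Qed.

Lemma affine_AGL1 x y : x != y ->
  exists2 h, h \in AGL1 F & forall u, h u = (y - x) * u + x.
Proof.
rewrite eq_sym -subr_eq0 => yx.
exists (perm (affine_fun_inj yx (b := x))).
  by apply/AGL1P; exists (y - x), x; split=> // u; rewrite permE.
by move=> u; rewrite permE.
Qed.

Lemma AGL1_transitive2 : [transitive^2 AGL1_group F, on [set: F] | 'P].
Proof.
apply/imsetP; exists [tuple 0; 1] => [|].
  rewrite inE /= inE eq_sym oner_neq0; apply/subsetP => x _; exact: in_setT.
apply/setP => t; rewrite inE.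
case: t => [[|x [|y [|]]]] //= szt; rewrite inE.
apply/andP/imsetP => [[]|[h /AGL1P[a [b [a0 hE]]]]].
  rewrite andbT => xy _; have [h hH hE] := affine_AGL1 xy; exists h => //.
  by apply: val_inj; rewrite /= /aperm !hE mulr0 add0r mulr1 subrK.
move/(congr1 val) => /= [-> ->]; rewrite /aperm !hE mulr0 add0r mulr1 andbT.
split; last by apply/subsetP => u _; apply: in_setT.
by rewrite -subr_eq0 opprD addrA addrAC subrr add0r oppr_eq0.
Qed.

(** An affine map is determined by the images of 0 and 1, hence the orbits on
    triples of distinct points are classified by the ratio [(z - x) / (y - x)]. *)
Lemma AGL1_orbit k x y z :
  ([tuple x; y; z] \in orbit ('P * 3)%act (AGL1 F) [tuple 0; 1; k])
  = (x != y) && (z == (y - x) * k + x).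
Proof.
apply/imsetP/andP => [[h /AGL1P[a [b [a0 hE]]]]|[xy /eqP->]].
  rewrite act_tuple3 /= /aperm !hE => /eqP.
  rewrite eq_tuple3 mulr0 add0r mulr1 => /and3P[/eqP-> /eqP-> /eqP->].
  rewrite addrK eqxx; split=> //.
  by rewrite -subr_eq0 opprD addrA addrAC subrr add0r oppr_eq0.
have [h hH hE] := affine_AGL1 xy; exists h => //.
by rewrite act_tuple3 /= /aperm !hE mulr0 add0r mulr1 subrK.
Qed.

End Affine.

(** * The two schemes on five points *)

(** Reduces a decidable statement on triples of points to a computation on
    natural numbers, where membership in the listed relations evaluates. *)
Lemma ord5_ind3 (P : nat -> nat -> nat -> bool) :
  all (fun a => all (fun b => all (P a b) (iota 0 5)) (iota 0 5)) (iota 0 5) ->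
  forall x y z : 'I_5, P x y z.
Proof.
move=> Pall x y z.
have ord_iota (i : 'I_5) : (i : nat) \in iota 0 5 by rewrite mem_iota ltn_ord.
by move/allP/(_ _ (ord_iota x))/allP/(_ _ (ord_iota y))/allP/(_ _ (ord_iota z)): Pall.
Qed.

Lemma in_triples5 (x y z : 'I_5) s :
  ([tuple x; y; z] \in triples5 s) = ([:: x.+1; y.+1; z.+1] \in s).
Proof. by rewrite inE. Qed.

Definition rotation : {perm 'F_5} := perm (addrI (1%R : 'F_5)).

Lemma rotation_AGL1 : rotation \in AGL1 'F_5.
Proof.
apply/AGL1P; exists 1%R, 1%R; split=> [|x]; first exact: oner_neq0.
by rewrite permE mul1r addrC.
Qed.

Lemma rotation_transitive : [transitive <[rotation]>%g, on [set: 'F_5] | 'P].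
Proof.
have rotX k : (rotation ^+ k)%g 0%R = k%:R%R.
  by elim: k => [|k IHk]; rewrite ?expg0 ?perm1 // expgSr permM IHk permE -mulrS.
apply/imsetP; exists 0%R => //; apply/setP => x; rewrite inE; symmetry.
by apply/imsetP; exists (rotation ^+ x)%g; rewrite ?mem_cycle //= /aperm rotX natr_Zp.
Qed.

Lemma F5_affineE (x y z k : 'F_5) :
  (z == (y - x) * k + x)%R = (z == ((y + (5 - x)) * k + x) %% 5 :> nat).
Proof. by rewrite -val_eqE /= modnDmr modnMml modnDml. Qed.

(** The relation [z = (y - x) * k + x] with [x != y] in ['F_5], on
    representatives in [0, 5); [5 - a] stands for [- a], so that no truncated
    subtraction occurs. *)
Definition ratio_rel k a b d :=
  (a != b) && (d == ((b + (5 - a)) * k + a) %% 5).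

Lemma triples5_orbit (k : 'F_5) s :
  all (fun a => all (fun b => all (fun d =>
      ([:: a.+1; b.+1; d.+1] \in s) == ratio_rel k a b d)
    (iota 0 5)) (iota 0 5)) (iota 0 5) ->
  triples5 s = orbit ('P * 3)%act (AGL1_group 'F_5) [tuple 0; 1; k]%R
    :> {set 3.-tuple 'F_5}.
Proof.
move=> sP; apply/setP => t; have [x [y [z ->]]] := tuple3P t.
rewrite AGL1_orbit F5_affineE -val_eqE [LHS]in_triples5; apply/eqP.
exact: (ord5_ind3 sP).
Qed.

Definition k2 : 'F_5 := @Ordinal 5 2 isT.
Definition k3 : 'F_5 := @Ordinal 5 3 isT.
Definition k4 : 'F_5 := @Ordinal 5 4 isT.

(** The relations [R4], [R5], [R6] are the orbits of ratio 2, 3 and 4.  The types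
    ['I_5] and ['F_5] are convertible, and typing the scheme over ['F_5] selects
    the field structure; the result is later used over ['I_5] as it stands. *)
Lemma AST5_second_properties :
  let S : 'I_7 -> {set 3.-tuple 'F_5} := AST5_second in
  induced_by (AGL1_group 'F_5) 'P S /\ is_AST S.
Proof.
pose L : seq {set 3.-tuple 'F_5} := [:: R4; R5; R6].
have F5_card : 4 <= #|'F_5| by rewrite card_ord.
have uniqL : uniq L.
  rewrite /= !inE negb_or -andbA andbT; apply/and3P.
  split; apply/eqP => /setP;
    [ move/(_ [tuple 0; 1; k2]%R) | move/(_ [tuple 0; 1; k2]%R)
    | move/(_ [tuple 0; 1; k3]%R) ];
  by rewrite !in_triples5.
have orbL D : D \in L -> exists x y z, uniq [:: x; y; z] /\
    D = orbit ('P * 3)%act (AGL1_group 'F_5) [tuple x; y; z].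
  rewrite !inE => /or3P[]/eqP->; exists 0%R, 1%R.
  - by exists k2; split=> //; apply: triples5_orbit; vm_compute.
  - by exists k3; split=> //; apply: triples5_orbit; vm_compute.
  by exists k4; split=> //; apply: triples5_orbit; vm_compute.
have covL (x y z : 'F_5) : uniq [:: x; y; z] ->
    exists2 D, D \in L & [tuple x; y; z] \in D.
  move=> u.
  suff : [|| [tuple x; y; z] \in R4, [tuple x; y; z] \in R5 | [tuple x; y; z] \in R6].
    case/or3P => xyz; [exists R4|exists R5|exists R6] => //;
    by rewrite !inE eqxx ?orbT.
  rewrite !in_triples5; apply: implyP u; rewrite -(map_inj_uniq val_inj).
  move: x y z; by apply: (@ord5_ind3 (fun a b d => uniq [:: a; b; d] ==>
    [|| [:: a.+1; b.+1; d.+1] \in _, [:: a.+1; b.+1; d.+1] \in _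
      | [:: a.+1; b.+1; d.+1] \in _])); vm_compute.
split.
  exact: (orbit_scheme_induced (AGL1_transitive2 _) F5_card orbL covL).
exact: (orbit_scheme_AST (AGL1_transitive2 _) F5_card
  (isT : L != [::]) uniqL orbL covL).
Qed.

Lemma AST5_second_circulant : circulant AST5_second.
Proof.
have [indS _] := AST5_second_properties.
exact: (circulant_of_orbits indS rotation_AGL1 rotation_transitive).
Qed.

(** The symmetric group on five points is three-transitive, so all triples of
    distinct points form a single orbit. *)
Lemma AST5_first_properties :
  is_AST AST5_first /\ induced_by 'Sym_('I_5)%G 'P AST5_first.
Proof.
pose D := [set: 3.-tuple 'I_5] :\:
       (triv0 'I_5 :|: triv1 'I_5 :|: triv2 'I_5 :|: triv3 'I_5).
have DE x y z : ([tuple x; y; z] \in D) = uniq [:: x; y; z].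
  rewrite !inE in_triv0 in_triv1 in_triv2 in_triv3 /= !inE.
  by case: (x == y); case: (x == z); case: (y == z).
have tr5 : [transitive^5 'Sym_('I_5)%G, on setT | 'P].
  by have := Sym_trans 'I_5; rewrite card_ord.
have card5 : 4 <= #|'I_5| by rewrite card_ord.
have orbD E : E \in [:: D] -> exists x y z, uniq [:: x; y; z] /\
    E = orbit ('P * 3)%act 'Sym_('I_5)%G [tuple x; y; z].
  rewrite inE => /eqP->; exists (inord 0), (inord 1), (inord 2).
  have u : uniq [:: inord 0 : 'I_5; inord 1; inord 2].
    by rewrite -(map_inj_uniq val_inj) /= !inordK.
  split=> //; apply/setP => t.
  rewrite (atransP (ntransitive_weak (isT : 3 <= 5) tr5)).
    have [x [y [z ->]]] := tuple3P t; rewrite DE inE.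
    by rewrite [RHS]andbC; case: subsetP => // -[] ? _; rewrite inE.
  by rewrite inE u; apply/subsetP => x _; rewrite inE.
have covD x y z : uniq [:: x; y; z] -> exists2 E, E \in [:: D] & [tuple x; y; z] \in E.
  by move=> u; exists D; rewrite ?mem_head // DE.
have tr2 := ntransitive_weak (isT : 2 <= 5) tr5.
split; first exact: (orbit_scheme_AST tr2 card5 (isT : [:: D] != [::]) isT orbD covD).
exact: (orbit_scheme_induced tr2 card5 orbD covD).
Qed.

Lemma AST5_first_circulant : circulant AST5_first.
Proof.
have [_ indS] := AST5_first_properties.
apply: (circulant_of_orbits indS _ rotation_transitive).
exact: in_setT.
Qed.

(** * A swap-stable relation of odd valency *)

(** The non-fixed points of the involution contribute the same amount on either
    side of the order of ['I_m], so they contribute an even amount in total. *)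
Lemma odd_sum_involution m (P : pred 'I_m) (f : 'I_m -> 'I_m) (n : 'I_m -> nat) :
  involutive f -> (forall i, P (f i) = P i) -> (forall i, n (f i) = n i) ->
  odd (\sum_(i | P i) n i) -> exists i, [/\ P i, f i = i & odd (n i)].
Proof.
move=> fK Pf nf odd_sum.
have [/existsP[i /and3P[Pi /eqP fi ni]]|none] :=
  boolP [exists i, [&& P i, f i == i & odd (n i)]]; first by exists i.
have even_fix: ~~ odd (\sum_(i | P i && (f i == i)) n i).
  elim/big_ind: _ => // [a b|i /andP[Pi fi]]; first by rewrite oddD; do 2 case: odd.
  by apply: contra none => ni; apply/existsP; exists i; rewrite Pi fi.
have halves: \sum_(i | P i && (f i < i)) n i = \sum_(i | P i && (i < f i)) n i.
  rewrite (reindex_inj (inv_inj fK)) /=.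
  by apply: eq_big => [i|i _]; rewrite ?Pf ?fK ?nf.
move: odd_sum; rewrite (bigID (fun i => f i == i)) /= oddD (negbTE even_fix) /=.
rewrite (bigID (fun i : 'I_m => f i < i)) /=.
rewrite (eq_bigl (fun i => P i && (f i < i))); last first.
  by move=> i; rewrite -val_eqE; case: ltngtP; rewrite ?andbT ?andbF.
rewrite halves (eq_bigl (fun i => P i && (i < f i))).
  by rewrite oddD addbb.
by move=> i; rewrite -val_eqE; case: ltngtP; rewrite ?andbT ?andbF.
Qed.

Section Parity.
Variables (T : finType) (m : nat) (R : 'I_m.+1 -> {set 3.-tuple T}).
Hypothesis A : is_AST R.

(** A sum rather than the cardinal of a set, so that it can be exchanged with the
    sums over the relations and over the second point. *)
Definition valency (x y : T) i := \sum_z ([tuple x; y; z] \in R i).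

Lemma valencyE x y i : valency x y i = #|[set z | [tuple x; y; z] \in R i]|.
Proof. by rewrite -sum1dep_card big_mkcond. Qed.

Lemma valency_const x y x' y' i :
  x != y -> x' != y' -> valency x y i = valency x' y' i.
Proof.
move=> xy xy'; have [n valn] := AST_valency A i.
by rewrite !valencyE (valn _ _ xy) (valn _ _ xy').
Qed.

Lemma sum_valency (x y : T) :
  x != y -> \sum_(i < m.+1 | 4 <= i) valency x y i = #|T|.-2.
Proof.
move=> xy.
have -> : #|T|.-2 = #|~: [set x; y]| by rewrite cardsCs setCK cards2 xy subn2.
rewrite exchange_big /=.
rewrite -sum1_card [RHS]big_mkcond; apply: eq_bigr => z _.
have [i tRi] := AST_mem A [tuple x; y; z].
have := AST_nontrivial A tRi; rewrite !inE negb_or xy (eq_sym z) (eq_sym z).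
rewrite andTb => i4; rewrite -i4; case: ifP => i4'.
  rewrite (bigD1 i) //= tRi big1 ?addn0 // => j /andP[_ ji].
  by case tRj : (_ \in R j); rewrite // (AST_uniq A tRj tRi) eqxx in ji.
apply: big1 => j j4; case tRj : (_ \in R j) => //.
by rewrite (AST_uniq A tRj tRi) i4' in j4.
Qed.

(** Exchanging the last two coordinates is an involution on the nontrivial
    relations.  It preserves valencies, since [#|T|.-1] times the valency counts the
    triples of the relation with a given first point.  The valencies of the
    nontrivial relations add up to [#|T| - 2], which is odd, so one of the fixed
    relations has odd valency. *)
Lemma odd_swap23_stable : odd #|T| ->
  exists i : 'I_m.+1, [/\ 4 <= i, permute_coords swap23 (R i) = R i
    & forall x y, x != y -> odd #|[set z | [tuple x; y; z] \in R i]|].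
Proof.
move=> oddT; have [f swapf] := AST_permute A swap23.
have fK : involutive f.
  move=> i; apply: (AST_inj A); rewrite -!swapf; apply/setP => t.
  by have [x [y [z ->]]] := tuple3P t; rewrite !in_swap23.
have f4 (i : 'I_m.+1) : (4 <= f i) = (4 <= i).
  by apply/idP/idP => [|] /(AST_permute_nontrivial A (swapf _)); rewrite ?fK.
have /card_gt1P[x [y [_ _ xy]]] : 1 < #|T| := ltnW (AST_card A).
have val_total (i : 'I_m.+1) : 4 <= i ->
    #|T|.-1 * valency x y i = \sum_u \sum_v ([tuple x; u; v] \in R i).
  move=> i4; rewrite (bigD1 x) //= [X in X + _]big1 => [|v _].
    rewrite add0n -(cardC1 x) -sum_nat_const.
    by apply: eq_big => // u; rewrite inE eq_sym => xu; apply: valency_const.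
  by case tRi : (_ \in R i); rewrite // (AST_nontrivial A tRi) eqxx in i4.
have val_f (i : 'I_m.+1) : 4 <= i -> valency x y (f i) = valency x y i.
  move=> i4; apply/eqP.
  have T1 : 0 < #|T|.-1 by rewrite -subn1 subn_gt0 ltnW // (AST_card A).
  rewrite -(eqn_pmul2l T1) !val_total ?f4 //.
  rewrite exchange_big /=; apply/eqP; apply: eq_bigr => u _; apply: eq_bigr => v _.
  by rewrite -swapf in_swap23.
have [||i [i4 fi odd_i]] := @odd_sum_involution _ (fun i : 'I_m.+1 => 4 <= i) f
   (fun i : 'I_m.+1 => if 4 <= i then valency x y i else 0) fK f4.
- by move=> i; rewrite f4; case: ifP => // /val_f.
- rewrite -(@eq_bigr _ _ _ _ _ _ (valency x y)) => [|i ->//].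
  rewrite sum_valency //.
  by move: oddT (AST_card A); case: #|T| => [|[|n]] //=; rewrite negbK.
rewrite i4 in odd_i; exists i; split=> //; first by rewrite swapf fi.
by move=> x' y' xy'; rewrite -valencyE (valency_const _ xy' xy).
Qed.

End Parity.

(** * Circulant schemes on five points *)

(** A generator of a transitive cyclic group is a single cycle [c], and it maps
    each relation onto itself because the relations are disjoint. *)
Lemma circulant_coordinates (T : finType) m (R : 'I_m.+1 -> {set 3.-tuple T}) :
  is_AST R -> circulant R ->
  exists c : nat -> T,
    [/\ {in gtn #|T| &, injective c}, forall k, c (k + #|T|) = c k
      & forall i a b d, ([tuple c a.+1; c b.+1; c d.+1] \in R i)
          = ([tuple c a; c b; c d] \in R i)].
Proof.
move=> A [G [trG /cyclicP[g defG] stabR]].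
have /card_gt0P[x0 _] : 0 < #|T| by apply: leq_trans (AST_card A).
have cardg : #|porbit g x0| = #|T|.
  by rewrite porbitE -defG -/(orbit _ _ _) (atransP trG) ?inE // cardsT.
exists (fun k => iter k g x0); split.
- move=> a b; rewrite !inE -cardg => lt_a lt_b.
  have := uniq_traject_porbit g x0.
  move/(uniqP x0)/(_ a b); rewrite !inE size_traject !nth_traject //.
  exact.
- by move=> k; rewrite iterD -{1}cardg iter_porbit.
have fwd i x y z : [tuple x; y; z] \in R i -> [tuple g x; g y; g z] \in R i.
  move=> tRi; apply: (subsetP (stabR i)); apply/imset2P.
  exists g [tuple x; y; z] => //; first by rewrite defG cycle_id.
  exact: val_inj.
move=> i a b d; rewrite !iterS; apply/idP/idP; last exact: fwd.
move=> gRi; have [j tRj] := AST_mem A [tuple iter a g x0; iter b g x0; iter d g x0].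
by rewrite (AST_uniq A gRi (fwd _ _ _ _ tRj)).
Qed.

(** Among the three perfect matchings of 1, 2, 3, 4, only {14, 23} realizes every
    nonzero difference modulo 5: {12, 34} misses the difference 2, and {13, 24}
    misses the difference 1. *)
Lemma unique_matching (u : nat -> nat -> bool) :
  (forall a b, u a b -> uniq [:: 0; a; b]) ->
  (forall a b, u a b = u b a) ->
  (forall a, 0 < a < 5 -> exists2 b, b < 5 & u a b) ->
  (forall a b b', b < 5 -> b' < 5 -> u a b -> u a b' -> b = b') ->
  (forall d, 0 < d < 5 -> exists2 a, a < 5 & u a ((a + d) %% 5)) ->
  forall a b, a < 5 -> b < 5 -> u a b = (0 < a) && (a + b == 5).
Proof.
move=> u_distinct u_sym u_ex u_fun u_diff.
have clash a b b' : u a b -> b < 5 -> b' < 5 -> b != b' -> u a b' = false.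
  by move=> uab b5 b'5; apply: contraNF => /(u_fun _ _ _ b5 b'5 uab)->.
have irr : (forall b, u 0 b = false) * (forall a, u a 0 = false)
    * (forall a, u a a = false).
  by split; first split; move=> a; apply/negbTE/negP => /u_distinct;
    rewrite /= ?inE ?eqxx ?orbT ?andbF.
have u14 : u 1 4.
  have [b b5 u1b] := u_ex 1 isT; have ub1 := u1b; rewrite u_sym in ub1.
  case: b b5 u1b ub1 => [|[|[|[|[|//]]]]] _ u1b ub1.
  - by rewrite irr in u1b.
  - by rewrite irr in u1b.
  - have [a a5] := u_diff 2 isT; case: a a5 => [|[|[|[|[|//]]]]] _;
      rewrite [modn _ _]/= ?irr //.
    + by rewrite (clash _ _ _ u1b).
    + by rewrite (clash _ _ _ ub1).
    by rewrite u_sym (clash _ _ _ u1b).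
  - have [a a5] := u_diff 1 isT; case: a a5 => [|[|[|[|[|//]]]]] _;
      rewrite [modn _ _]/= ?irr //.
    + by rewrite (clash _ _ _ u1b).
    + by rewrite u_sym (clash _ _ _ ub1).
    by rewrite (clash _ _ _ ub1).
  by [].
have u41 : u 4 1 by rewrite u_sym.
have u23 : u 2 3.
  have [b b5] := u_ex 2 isT; case: b b5 => [|[|[|[|[|//]]]]] _; rewrite ?irr //.
  - by rewrite u_sym (clash _ _ _ u14).
  by rewrite u_sym (clash _ _ _ u41).
have u32 : u 3 2 by rewrite u_sym.
move=> a b a5 b5.
by case: a a5 => [|[|[|[|[|//]]]]] _; case: b b5 => [|[|[|[|[|//]]]]] _;
  rewrite ?irr ?u14 ?u41 ?u23 ?u32 ?(clash _ _ _ u14) ?(clash _ _ _ u41)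
    ?(clash _ _ _ u23) ?(clash _ _ _ u32).
Qed.

Section FivePoints.
Variables (m : nat) (R : 'I_m.+1 -> {set 3.-tuple 'I_5}).
Hypotheses (A : is_AST R) (circR : circulant R).

(** The third points of the relation exhaust the complement of every pair, so the
    relation consists of all triples of distinct points. *)
Lemma valency_three (i : 'I_m.+1) :
  4 <= i -> (forall x y, x != y -> #|[set z | [tuple x; y; z] \in R i]| = 3) ->
  isomorphic R AST5_first.
Proof.
move=> i4 val3.
have RiE x y z : ([tuple x; y; z] \in R i) = uniq [:: x; y; z].
  apply/idP/idP => [tRi|].
    have := AST_nontrivial A tRi.
    by rewrite i4 => /esym; rewrite /= !inE negb_or andbT -andbA.
  rewrite /= !inE negb_or andbT -andbA => /and3P[xy xz yz].
  have /eqP/setP/(_ z) : [set w | [tuple x; y; w] \in R i] == ~: [set x; y].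
    by rewrite eqEcard (AST_fiber_sub A) // val3 // cardsCs setCK cards2 xy card_ord.
  by rewrite !inE negb_or ![z == _]eq_sym xz yz.
have [AF _] := AST5_first_properties.
apply: (isomorphic_by_coordinates (s := 1%g) A AF) => j.
suff [k Rk] : exists k, R k = AST5_first j.
  by exists k => x y z; rewrite !perm1 Rk.
rewrite -(inord_val j); case: (val j) (ltn_ord j) => [|[|[|[|[|//]]]]] _.
- by exists (inord 0); rewrite (AST_triv0 A) (AST_triv0 AF).
- by exists (inord 1); rewrite (AST_triv1 A) (AST_triv1 AF).
- by exists (inord 2); rewrite (AST_triv2 A) (AST_triv2 AF).
- by exists (inord 3); rewrite (AST_triv3 A) (AST_triv3 AF).
exists i; apply/setP => t; have [x [y [z ->]]] := tuple3P t.
rewrite RiE /AST5_first inordK //= !inE in_triv0 in_triv1 in_triv2 in_triv3.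
by case: (x == y); case: (x == z); case: (y == z).
Qed.

(** Fixing the first point to be [c 0], the relation becomes a perfect matching
    [u] of the other four points.  Its image under the exchange of the outer
    coordinates has positive valency, that is, every pair of distinct points
    occurs in the last two positions; rotating the first point to [c 0] shows that
    every difference occurs in the matching, which is thus {14, 23}.  The rotated
    copies of this matching make up [R6]. *)
Lemma valency_one (i : 'I_m.+1) :
  4 <= i -> permute_coords swap23 (R i) = R i ->
  (forall x y, x != y -> #|[set z | [tuple x; y; z] \in R i]| = 1) ->
  exists s : {perm 'I_5}, forall x y z,
    ([tuple s x; s y; s z] \in R i) = ([tuple x; y; z] \in R6).
Proof.
move=> i4 swap_i val1; have [c []] := circulant_coordinates A circR.
rewrite card_ord => c_inj c_per c_shift.
have shift k a b d : ([tuple c (k + a); c (k + b); c (k + d)] \in R i)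
    = ([tuple c a; c b; c d] \in R i).
  by elim: k => // k IHk; rewrite !addSn c_shift.
have c_mod k : c (k %% 5) = c k.
  rewrite {2}(divn_eq k 5); elim: (k %/ 5) => [|q IHq] //.
  by rewrite mulSn -addnA addnC c_per.
have c_neq a b : a < 5 -> b < 5 -> (c a == c b) = (a == b).
  by move=> a5 b5; apply/eqP/eqP => [/c_inj->|->].
have s_inj : injective (fun x : 'I_5 => c x).
  by move=> x y /c_inj e; apply/val_inj/e; apply: ltn_ord.
have c_onto x : exists2 b, b < 5 & c b = x.
  have /codomP[b ->] : x \in codom (fun x : 'I_5 => c x).
    by apply: inj_card_onto.
  by exists b.
pose u a b := [&& a < 5, b < 5 & [tuple c 0; c a; c b] \in R i].
have distinct a b : [tuple c 0; c a; c b] \in R i ->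
    [&& c 0 != c a, c 0 != c b & c a != c b].
  by move=> tRi; rewrite -(AST_nontrivial A tRi).
have uE a b : a < 5 -> b < 5 -> u a b = (0 < a) && (a + b == 5).
  apply: unique_matching; rewrite /u {a b}.
  - move=> a b /and3P[a5 b5 /distinct]; rewrite !c_neq //=.
    by rewrite !inE negb_or andbT -andbA.
  - move=> a b; rewrite andbCA -swap_i in_swap23; do 2!congr (_ && _).
    by rewrite swap_i.
  - move=> a /andP[a0 a5]; have c0a : c 0 != c a by rewrite c_neq // neq_ltn a0.
    have [x] := AST_extend A i4 c0a; have [b b5 <-] := c_onto x => tRi.
    by exists b; rewrite ?a5 ?b5.
  - move=> a b b' b5 b'5 /and3P[a5 _ tb] /and3P[_ _ tb'].
    have /and3P[c0a _ _] := distinct _ _ tb.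
    have /eqP/cards1P[x ex] := val1 _ _ c0a.
    apply: c_inj => //; move/setP: ex => ex.
    have := ex (c b); have := ex (c b').
    by rewrite !inE tb tb' => /esym/eqP-> /esym/eqP->.
  move=> d /andP[d0 d5].
  (* The first point [c b] is rotated to [c 0] by [5 - b] steps. *)
  have [j swap_j] := AST_sym A i swap13.
  have j4 : 4 <= j := AST_permute_nontrivial A swap_j i4.
  have cd0 : c d != c 0 by rewrite c_neq // eq_sym neq_ltn d0.
  have [x] := AST_extend A j4 cd0; have [b b5 <-] := c_onto x.
  rewrite -swap_j in_swap13 -(shift (5 - b)) subnK 1?ltnW // addn0.
  rewrite (c_per 0 : c 5 = c 0) -(c_mod (5 - b)) -(c_mod (_ + d)) => tRi.
  exists ((5 - b) %% 5); first exact: ltn_pmod.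
  by rewrite modnDml !ltn_pmod.
exists (perm s_inj) => x y z; rewrite !permE -(shift (5 - x)) subnK 1?ltnW //.
rewrite (c_per 0 : c 5 = c 0) -(c_mod (5 - x + y)) -(c_mod (5 - x + z)).
have := uE _ _ (ltn_pmod (5 - x + y) (isT : 0 < 5)) (ltn_pmod (5 - x + z) (isT : 0 < 5)).
rewrite {1}/u !ltn_pmod //= => ->; rewrite in_triples5; apply/eqP.
by move: x y z; apply: (@ord5_ind3 (fun x y z => (0 < (5 - x + y) %% 5) &&
  ((5 - x + y) %% 5 + (5 - x + z) %% 5 == 5) == ([:: x.+1; y.+1; z.+1] \in _)));
  vm_compute.
Qed.

Lemma swap12_R6 x y z : ([tuple y; x; z] \in R6) = ([tuple x; y; z] \in R4).
Proof.
rewrite !in_triples5; apply/eqP; move: x y z.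
by apply: (@ord5_ind3 (fun x y z => ([:: y.+1; x.+1; z.+1] \in _) ==
  ([:: x.+1; y.+1; z.+1] \in _))); vm_compute.
Qed.

Lemma swap13_R6 x y z : ([tuple z; y; x] \in R6) = ([tuple x; y; z] \in R5).
Proof.
rewrite !in_triples5; apply/eqP; move: x y z.
by apply: (@ord5_ind3 (fun x y z => ([:: z.+1; y.+1; x.+1] \in _) ==
  ([:: x.+1; y.+1; z.+1] \in _))); vm_compute.
Qed.

(** The swap-stable relation of odd valency has valency 3 or 1.  In the latter case
    it is [R6] in suitable coordinates, and [R4], [R5] are obtained from [R6] by
    permuting coordinates, so they also are relations of the scheme. *)
Lemma AST5_classification : isomorphic R AST5_first \/ isomorphic R AST5_second.
Proof.
have [|i [i4 swap_i odd_i]] := odd_swap23_stable A; first by rewrite card_ord.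
have x01 : (inord 0 : 'I_5) != inord 1 by rewrite -val_eqE /= !inordK.
have [n valn] := AST_valency A i.
have n_le3 : n <= 3.
  have := subset_leq_card (AST_fiber_sub A i4 x01).
  by rewrite (valn _ _ x01) cardsCs setCK cards2 x01 card_ord.
have odd_n : odd n by rewrite -(valn _ _ x01) odd_i.
case: n n_le3 odd_n valn => [//|[|[//|[|//]]]] _ _ valn; last first.
  by left; apply: valency_three valn.
right; have [s RiE] := valency_one i4 swap_i valn.
have [_ AS] := AST5_second_properties.
apply: (isomorphic_by_coordinates (s := s) A AS) => j.
have s_eq := inj_eq (@perm_inj _ s).
rewrite -(inord_val j); case: (val j) (ltn_ord j) => [|[|[|[|[|[|[|//]]]]]]] _.
- exists (inord 0) => x y z.
  by rewrite (AST_triv0 A) (AST_triv0 AS) !in_triv0 !s_eq.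
- exists (inord 1) => x y z.
  by rewrite (AST_triv1 A) (AST_triv1 AS) !in_triv1 !s_eq.
- exists (inord 2) => x y z.
  by rewrite (AST_triv2 A) (AST_triv2 AS) !in_triv2 !s_eq.
- exists (inord 3) => x y z.
  by rewrite (AST_triv3 A) (AST_triv3 AS) !in_triv3 !s_eq.
- have [k swap_k] := AST_sym A i swap12; exists k => x y z.
  by rewrite /AST5_second inordK //= -swap_k in_swap12 RiE swap12_R6.
- have [k swap_k] := AST_sym A i swap13; exists k => x y z.
  by rewrite /AST5_second inordK //= -swap_k in_swap13 RiE swap13_R6.
by exists i => x y z; rewrite /AST5_second inordK //= RiE.
Qed.

End FivePoints.

Theorem mainTheorem5 :
  [/\ is_AST AST5_first /\ circulant AST5_first,
      is_AST AST5_second /\ circulant AST5_second,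
      ~ isomorphic AST5_first AST5_second,
      forall (m : nat) (R : 'I_m.+1 -> {set 3.-tuple 'I_5}),
        is_AST R -> circulant R ->
        isomorphic R AST5_first \/ isomorphic R AST5_second
    & exists f : 'I_5 -> 'F_5, bijective f /\
        induced_by (AGL1_group 'F_5) 'P (fun i => relabel f (AST5_second i))].
Proof.
have [AF _] := AST5_first_properties; have [indS AS] := AST5_second_properties.
split.
- by split; [|exact: AST5_first_circulant].
- by split; [|exact: AST5_second_circulant].
- by case.
- exact: AST5_classification.
exists id; split; first by exists id.
suff relabel_id (D : {set 3.-tuple 'F_5}) : relabel id D = D.
  case: indS => F4 tr2 orbS; split=> //; rewrite -orbS.
  by apply: eq_imset => i; apply: relabel_id.
rewrite /relabel -[RHS]imset_id; apply: eq_imset => t.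
by apply: val_inj; rewrite /= map_id.
Qed.
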